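(* Let $\mathcal{C}\subseteq\mathbb{R}^n$ be a compact convex set, let $f\colon\mathcal{C}\to\mathbb{R}$ be convex and differentiable in an open set containing $\mathcal{C}$, and let $\eta_t=\frac{\ell}{t+\ell}$ for some integer $\ell\ge 2$ and all $t\in\mathbb{N}$. Let $(x_t)_{t\in\mathbb{N}}$ be the iterates of the Frank-Wolfe algorithm with step-sizes $\eta_t$. Suppose that $(\mathcal{C},f)$ satisfies the strong $(M,0)$-growth property for some $M>0$, and suppose that there exist $r\in(0,1)$, $m>0$, and an integer threshold $$S\ge\max\left\{1,\left\lceil\frac{2^{1/r}\ell M}{m^{1/r}}-\ell\right\rceil\right\}$$ such that for all integers $t\ge S$ either $$\mathrm{subopt}_t<\left(\frac{\eta_tM}{m}\right)^{\frac{1}{1-r}}\qquad\text{or}\qquad m\cdot\mathrm{subopt}_t^{1-r}\le\mathrm{gap}_t.$$ Then, for all integers $t\ge S$, $$\mathrm{subopt}_t\le\max\left\{\mathrm{subopt}_S\left(\frac{\eta_{t-1}}{\eta_{S-1}}\right)^{\ell},\ \eta_{t-1}^{\min\{\ell,\frac{1}{1-r},2\}}\left(\left(\frac{M}{m}\right)^{\frac{1}{1-r}}+\frac{M}{2}\right)\right\}.$$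
   Context: $\mathbb{N}=\{0,1,2,\ldots\}$. Frank-Wolfe algorithm for $\min_{x\in\mathcal{C}}f(x)$ with step-sizes $\eta_t\in[0,1]$: given any $x_0\in\mathcal{C}$, for $t=0,1,2,\ldots$ choose any $v_t\in\operatorname{argmin}_{v\in\mathcal{C}}\langle\nabla f(x_t),v-x_t\rangle$ and set $x_{t+1}=x_t+\eta_t(v_t-x_t)$. For $x,y\in\mathcal{C}$: $D_f(y,x)=f(y)-f(x)-\langle\nabla f(x),y-x\rangle$, $\mathrm{subopt}(x)=f(x)-\min_{y\in\mathcal{C}}f(y)$, and $\mathrm{gap}(x)=\max_{v\in\mathcal{C}}\langle\nabla f(x),x-v\rangle$. For the iterates, $\mathrm{subopt}_t=\mathrm{subopt}(x_t)$ and $\mathrm{gap}_t=\mathrm{gap}(x_t)$. Strong $(M,0)$-growth property: for all $x\in\mathcal{C}$ and all $v\in\operatorname{argmin}_{y\in\mathcal{C}}\langle\nabla f(x),y-x\rangle$, $D_f(x+\eta(v-x),x)\le\frac{M\eta^2}{2}$ for all $\eta\in[0,1]$. (The either/or hypothesis is what the paper calls the relaxed gaps growth property of $(\mathcal{C},f,(x_t)_{t\in\mathbb{N}},(\delta_t)_{t\in\mathbb{N}})$ with $\delta_t=(\eta_tM/m)^{1/(1-r)}$ and threshold $S$.) *)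

(* Defs.v *)
From HB Require Import structures.
From mathcomp Require Import all_boot all_order all_algebra.
From mathcomp Require Import all_classical all_reals all_analysis.

Set Implicit Arguments.
Unset Strict Implicit.
Unset Printing Implicit Defensive.

Import Order.TTheory GRing.Theory Num.Theory.
Import numFieldNormedType.Exports.

Local Open Scope classical_set_scope.
Local Open Scope ring_scope.

Definition dotp (R : realType) (n : nat) (u v : 'rV[R]_n) : R :=
  \sum_(i < n) u 0 i * v 0 i.

Definition grad (R : realType) (n : nat) (f : 'rV[R]_n -> R) (x : 'rV[R]_n) :
  'rV[R]_n := \row_(i < n) 'D_(delta_mx 0 i) f x.

Definition bregman (R : realType) (n : nat) (f : 'rV[R]_n -> R)
  (y x : 'rV[R]_n) : R := f y - f x - dotp (grad f x) (y - x).

Definition argmin (R : realType) (T : Type) (C : set T) (g : T -> R) : set T :=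
  [set v | C v /\ forall y, C y -> g v <= g y].

(* The set of Frank-Wolfe vertices at x, that is, the possible outputs of the
   linear minimization oracle. *)
Definition fw_vertices (R : realType) (n : nat) (C : set 'rV[R]_n)
  (f : 'rV[R]_n -> R) (x : 'rV[R]_n) : set 'rV[R]_n :=
  argmin C (fun v => dotp (grad f x) (v - x)).

(* inf and sup stand for min and max: for C compact and nonempty and f
   differentiable on a neighborhood of C, both are attained
   (see subopt_min and fw_gap_max). *)
Definition subopt (R : realType) (n : nat) (C : set 'rV[R]_n)
  (f : 'rV[R]_n -> R) (x : 'rV[R]_n) : R := f x - inf [set f y | y in C].

Definition fw_gap (R : realType) (n : nat) (C : set 'rV[R]_n)
  (f : 'rV[R]_n -> R) (x : 'rV[R]_n) : R :=
  sup [set dotp (grad f x) (x - v) | v in C].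

Definition frank_wolfe (R : realType) (n : nat) (C : set 'rV[R]_n)
  (f : 'rV[R]_n -> R) (eta : nat -> R) (x v : nat -> 'rV[R]_n) : Prop :=
  C (x 0%N) /\
  forall t : nat,
    fw_vertices C f (x t) (v t) /\ x t.+1 = x t + eta t *: (v t - x t).

(* The strong (M, r)-growth property in the case r = 0. *)
Definition strong_growth0 (R : realType) (n : nat) (C : set 'rV[R]_n)
  (f : 'rV[R]_n -> R) (M : R) : Prop :=
  forall x v : 'rV[R]_n, C x -> fw_vertices C f x v ->
  forall eta : R, 0 <= eta <= 1 ->
    bregman f (x + eta *: (v - x)) x <= M * eta ^+ 2 / 2.

Definition open_loop_step (R : realType) (l t : nat) : R :=
  l%:R / (t%:R + l%:R).

Lemma dotp_grad (R : realType) (n : nat) (f : 'rV[R]_n -> R)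
  (x u : 'rV[R]_n) : differentiable f x -> dotp (grad f x) u = 'd f x u.
Proof.
move=> df; rewrite [in RHS](row_sum_delta u) linear_sum; apply: eq_bigr => i _.
by rewrite mxE deriveE// linearZ/= mulrC.
Qed.

Lemma dotp_continuous (R : realType) (n : nat) (a : 'rV[R]_n) :
  continuous (dotp a).
Proof.
move=> v; apply: cvg_big => [||i _]; [exact: add_continuous|exact: nbhs_filter|].
by apply: cvgMl_tmp; [exact: nbhs_filter|exact: coord_continuous].
Qed.

Lemma subopt_min (R : realType) (n : nat) (C : set 'rV[R]_n)
  (f : 'rV[R]_n -> R) :
  C !=set0 -> compact C -> (forall y, C y -> differentiable f y) ->
  exists2 z, argmin C f z & forall x, subopt C f x = f x - f z.
Proof.
move=> C0 Cc df.
have [|z zC zmin] := @EVT_min_rV R n f C C0 Cc.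
  by apply: continuous_in_subspaceT => y /set_mem /df /differentiable_continuous.
rewrite inE in zC.
have zmin' y : C y -> f z <= f y by move=> Cy; apply: zmin; rewrite inE.
exists z => // x; rewrite /subopt; congr (_ - _).
apply/eqP; rewrite eq_le; apply/andP; split.
  apply: ge_inf; last by exists z.
  by exists (f z) => _ [y Cy <-]; exact: zmin'.
by apply: lb_le_inf => [|_ [y Cy <-]]; [exists (f z), z|exact: zmin'].
Qed.

Lemma fw_gap_max (R : realType) (n : nat) (C : set 'rV[R]_n)
  (f : 'rV[R]_n -> R) (x : 'rV[R]_n) :
  C !=set0 -> compact C ->
  exists2 v, fw_vertices C f x v & fw_gap C f x = dotp (grad f x) (x - v).
Proof.
move=> C0 Cc.
have dN w : dotp (grad f x) (x - w) = - dotp (grad f x) (w - x).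
  by rewrite -sumrN; apply: eq_bigr => i _; rewrite -mulrN !mxE opprB.
have [|v vC vmin] :=
    @EVT_min_rV R n (fun v => dotp (grad f x) (v - x)) C C0 Cc.
  apply: continuous_subspaceT => w.
  apply: (cvg_comp (fun w => w - x) (dotp (grad f x)) _ (@dotp_continuous _ _ _ _)).
  apply: cvgB; [exact: nbhs_filter|exact: cvg_id|].
  by apply: cvg_cst; exact: nbhs_filter.
rewrite inE in vC.
have vmin' y : C y -> dotp (grad f x) (v - x) <= dotp (grad f x) (y - x).
  by move=> Cy; apply: vmin; rewrite inE.
exists v => //; apply/eqP; rewrite eq_le; apply/andP; split.
  apply: ge_sup => [|_ [y Cy <-]]; first by exists (dotp (grad f x) (x - v)), v.
  by rewrite !dN lerN2 vmin'.
apply: ub_le_sup; last by exists v.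
exists (dotp (grad f x) (x - v)) => _ [y Cy <-].
by rewrite !dN lerN2 vmin'.
Qed.

(* Main.v *)
Require Import Defs.
From HB Require Import structures.
From mathcomp Require Import all_boot all_order all_algebra.
From mathcomp Require Import all_classical all_reals all_analysis.
From mathcomp Require Import ring lra.

Import Order.TTheory GRing.Theory Num.Theory.
Import numFieldNormedType.Exports.

Local Open Scope classical_set_scope.
Local Open Scope ring_scope.

(** Put [h t = subopt_t] and [g t = gap_t].  Convexity and strong growth give
    [h t <= g t] and [h (t+1) <= h t - eta_t g t + M eta_t^2 / 2], from which
    [h t <= M eta_t] for all [t >= 1].  If [h t < (eta_t M / m)^(1/(1-r))], one
    step yields the second term of the maximum at [t+1].  Otherwise
    [h t^(1-r) >= eta_t M / m], so [g t >= eta_t M] absorbs the quadratic term,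
    while [h t <= M eta_S <= (m/2)^(1/r)] (this is the lower bound on [S]) turns
    [m h t^(1-r) <= g t] into [g t >= 2 h t].  Hence
    [h (t+1) <= (1 - eta_t) h t], and Bernoulli's inequality gives
    [1 - eta_t <= (eta_t / eta_{t-1})^l], under which both terms of the maximum
    propagate since the exponent of the second one is at most [l]. *)

(** * First-order inequality for convex functions *)

Lemma convex_gradient_le (R : realType) (n : nat) (C : set 'rV[R]_n)
    (f : 'rV[R]_n -> R) (x y : 'rV[R]_n) :
  convex_function C f -> C x -> C y -> differentiable f x ->
  dotp (grad f x) (y - x) <= f y - f x.
Proof.
move=> cf Cx Cy df; rewrite dotp_grad// -deriveE//.
have dv : derivable f x (y - x) by exact: diff_derivable.
(* Convexity bounds the difference quotient at [h] by [f y - f x] only for [h] in (0, 1], so the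
   two-sided limit is restricted to the right of [0]. *)
have right_sub : (0 : R)^'+ `=>` (0 : R)^'.
  move=> P /nbhs_ballP[e /= e0 P0]; apply/nbhs_ballP; exists e => //= z zb z0.
  by apply: P0 => //; rewrite /= gt_eqF.
have cvgd : (h^-1 *: ((f \o shift x) (h *: (y - x)) - f x) @[h --> (0 : R)^'+])
    --> 'D_(y - x) f x.
  by apply: cvg_trans dv => ? /right_sub.
rewrite -(cvg_lim _ cvgd)//; apply: limr_le.
  by apply/cvg_ex; eexists; exact: cvgd.
near=> h.
have h0 : 0 < h by near: h; exact: nbhs_right_gt.
have h1 : h <= 1 by near: h; exact: nbhs_right_le.
rewrite /GRing.scale/= ler_pdivrMl//.
have := cf (Itv01 (ltW h0) h1) y x (mem_set Cy) (mem_set Cx).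
rewrite convRE/= /unstable.onem.
have -> : conv (Itv01 (ltW h0) h1) (y : convex_lmodType 'rV[R]_n) x =
          h *: (y - x) + x.
  by rewrite /conv/= /unstable.onem scalerBl scale1r scalerBr addrAC addrA.
by move=> ?; lra.
Unshelve. all: by end_near.
Qed.

(** * Bernoulli's inequality and the open-loop step-sizes *)

Lemma bernoulli_le (R : realDomainType) (u : R) (n : nat) :
  u <= 1 -> 1 - n%:R * u <= (1 - u) ^+ n.
Proof.
move=> u1; elim: n => [|n IHn]; first by rewrite mul0r subr0 expr0.
rewrite exprS -natr1.
have : (1 - u) * (1 - n%:R * u) <= (1 - u) * (1 - u) ^+ n.
  by rewrite ler_wpM2l// subr_ge0.
have : 0 <= n%:R * u ^+ 2 by rewrite mulr_ge0 ?sqr_ge0.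
by rewrite expr2 => ? ?; nra.
Qed.

Section open_loop_step_theory.
Variables (R : realType) (l : nat).
Hypothesis l0 : (0 < l)%N.
Local Notation eta := (open_loop_step R l).

Let T0 t : 0 < (t%:R + l%:R : R).
Proof. by rewrite -natrD ltr0n addn_gt0 l0 orbT. Qed.

Lemma open_loop_step_gt0 t : 0 < eta t.
Proof. by rewrite divr_gt0// ltr0n. Qed.

Lemma open_loop_step_le1 t : eta t <= 1.
Proof. by rewrite ler_pdivrMr// mul1r lerDr. Qed.

Lemma open_loop_step_nonincr s t : (s <= t)%N -> eta t <= eta s.
Proof.
by move=> st; rewrite ler_pM2l ?ltr0n// lef_pV2 ?posrE// lerD2r ler_nat.
Qed.

(** With [u = 1 / (t + 1 + l)], the ratio of consecutive steps is [1 - u] and [eta t.+1 = l * u], so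
    this is Bernoulli's inequality with exponent [l]. *)
Lemma open_loop_step_contraction t : 1 - eta t.+1 <= (eta t.+1 / eta t) ^+ l.
Proof.
have T1 := T0 t.+1; have T0' := T0 t; have L0 : 0 < (l%:R : R) by rewrite ltr0n.
have -> : eta t.+1 / eta t = 1 - (t.+1%:R + l%:R)^-1.
  rewrite /open_loop_step -natr1; field.
  by rewrite natr1 !gt_eqF.
apply: bernoulli_le; rewrite invf_le1//.
by rewrite -natrD ler1n addSn.
Qed.

End open_loop_step_theory.

Lemma open_loop_step_succ (R : realType) (l t : nat) : (2 <= l)%N ->
  let eta := open_loop_step R l in eta t * (1 - eta t / 2) <= eta t.+1.
Proof.
move=> l2 /=; rewrite /open_loop_step -[t.+1%:R]natr1.
have L2 : 2 <= (l%:R : R) by rewrite ler_nat.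
have T0 : 0 <= (t%:R : R) by [].
have T1 : 0 < (t%:R + l%:R : R) by lra.
have T2 : 0 < (t%:R + 1 + l%:R : R) by lra.
rewrite -subr_ge0.
(* The sign of the difference rests on [(l - 2) * (t + l) + l], which is where [2 <= l] enters. *)
have -> : l%:R / (t%:R + 1 + l%:R) - l%:R / (t%:R + l%:R) *
    (1 - l%:R / (t%:R + l%:R) / 2) =
    l%:R * ((l%:R - 2) * (t%:R + l%:R) + l%:R) /
      (2 * (t%:R + l%:R) ^+ 2 * (t%:R + 1 + l%:R)) :> R.
  by field; rewrite !gt_eqF.
have T1l : 0 <= (l%:R - 2) * (t%:R + l%:R : R).
  by rewrite mulr_ge0 ?subr_ge0// ltW.
by rewrite divr_ge0 ?mulr_ge0 ?exprn_ge0// ?(ltW T1) ?(ltW T2)//; lra.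
Qed.

(** * The scalar recursion for suboptimality and gap *)

Section open_loop_recursion.
Variables (R : realType) (l : nat) (M : R) (h g : nat -> R).
Hypotheses (l2 : (2 <= l)%N) (M0 : 0 < M).
Local Notation eta := (open_loop_step R l).
Hypothesis h0 : forall t, 0 <= h t.
Hypothesis hg : forall t, h t <= g t.
Hypothesis hstep : forall t, h t.+1 <= h t - eta t * g t + M * eta t ^+ 2 / 2.

Let l0 : (0 < l)%N. Proof. exact: leq_trans l2. Qed.

(** Since [g s >= h s], the bound at [s] gives [h s.+1 <= M * eta s * (1 - eta s / 2)], and
    [open_loop_step_succ] closes the induction. *)
Lemma open_loop_step_bound t : h t.+1 <= M * eta t.+1.
Proof.
have eta0 s : 0 < eta s := open_loop_step_gt0 _ _ l0 s.
have eta1 s : eta s <= 1 := open_loop_step_le1 _ _ l0 s.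
(* The alternative [eta s = 1] serves [s = 0]: a full step cancels [h 0] against [g 0], so the
   induction starts from an arbitrary [h 0]. *)
have base s : h s <= M * eta s \/ eta s = 1 -> h s.+1 <= M * eta s.+1.
  move=> hs; apply: (@le_trans _ _ (M * (eta s * (1 - eta s / 2)))); last first.
    by rewrite ler_pM2l//; exact: open_loop_step_succ.
  apply: le_trans (hstep s) _.
  have := hg s; have := eta0 s; have := eta1 s.
  case: hs => [hs|->] => ? ? ?; last by lra.
  have : eta s * h s <= eta s * g s by rewrite ler_pM2l.
  have : (1 - eta s) * h s <= (1 - eta s) * (M * eta s).
    by rewrite ler_wpM2l// subr_ge0.
  by lra.
elim: t => [|t IHt]; apply: base; last by left.
by right; rewrite /open_loop_step add0r divff// pnatr_eq0 -lt0n.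
Qed.

(** The decrease [eta t * g t] is spent in two halves: by [g t >= eta t * M] one absorbs the
    quadratic term, and by [g t >= 2 * h t] the other is at least [eta t * h t]. *)
Lemma open_loop_growth_step (r m : R) (t : nat) : 0 < r < 1 -> 0 < m ->
  (eta t * M / m) `^ (1 - r)^-1 <= h t -> m * h t `^ (1 - r) <= g t ->
  h t <= (m / 2) `^ r^-1 -> h t.+1 <= (1 - eta t) * h t.
Proof.
move=> /andP[r0 r1] m0 hlb mg hub.
have et0 : 0 < eta t := open_loop_step_gt0 _ _ l0 t.
have r10 : 0 < 1 - r by rewrite subr_gt0.
have etM0 : 0 < eta t * M / m by rewrite divr_gt0// mulr_gt0.
have hlb' : eta t * M / m <= h t `^ (1 - r).
  have := ge0_ler_powR (ltW r10) (powR_ge0 _ _) (h0 t) hlb.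
  by rewrite -powRrM mulVf ?gt_eqF// powRr1// ltW.
have hub' : h t `^ r <= m / 2.
  have := ge0_ler_powR (ltW r0) (h0 t) (powR_ge0 _ _) hub.
  by rewrite -powRrM mulVf ?gt_eqF// powRr1// ltW// divr_gt0.
have g1 : eta t * M <= g t.
  by apply: le_trans mg; rewrite [leRHS]mulrC -ler_pdivrMr.
have g2 : h t <= g t / 2.
  (* The power law asks for a nonzero base or a nonzero exponent sum; here the sum is [1]. *)
  have -> : h t = h t `^ r * h t `^ (1 - r).
    rewrite -powRD ?subrKC ?powRr1//.
    by rewrite oner_eq0.
  have : h t `^ r * h t `^ (1 - r) <= m / 2 * h t `^ (1 - r).
    by rewrite ler_wpM2r// powR_ge0.
  by lra.
apply: le_trans (hstep t) _.
have : eta t * (eta t * M) <= eta t * g t by rewrite ler_pM2l.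
have : eta t * h t <= eta t * (g t / 2) by rewrite ler_pM2l.
by lra.
Qed.

(** As [eta t <= 1], lowering the exponents [q] and [2] to [p] only enlarges the powers of [eta t];
    the gap term is dropped by its sign. *)
Lemma open_loop_small_step (q p : R) (t : nat) : 0 < q -> p <= q -> p <= 2 ->
  forall m, 0 < m -> h t < (eta t * M / m) `^ q ->
  h t.+1 <= eta t `^ p * ((M / m) `^ q + M / 2).
Proof.
move=> q0 pq p2 m m0 ht.
have et0 : 0 < eta t := open_loop_step_gt0 _ _ l0 t.
have et1 : eta t <= 1 := open_loop_step_le1 _ _ l0 t.
have powM s : p <= s -> eta t `^ s <= eta t `^ p.
  move=> ps; rewrite /powR gt_eqF// ler_expR ler_wnM2r// ln_le0//.
have A0 : 0 <= (M / m) `^ q := powR_ge0 _ _.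
have : eta t `^ q * (M / m) `^ q <= eta t `^ p * (M / m) `^ q.
  by rewrite ler_wpM2r// powM.
have : eta t ^+ 2 * (M / 2) <= eta t `^ p * (M / 2).
  by rewrite ler_wpM2r ?divr_ge0 ?(ltW M0)// -powR_mulrn ?(ltW et0)// powM.
have := hstep t; have := hg t; have := h0 t.
move: ht; rewrite -mulrA powRM ?(ltW et0) ?divr_ge0 ?(ltW M0) ?(ltW m0)// => ? ? ? ? ? ?.
have : 0 <= eta t * g t by rewrite mulr_ge0 ?(ltW et0)// (le_trans (h0 t)).
by lra.
Qed.

Lemma open_loop_rate (r m : R) (S : nat) : 0 < r < 1 -> 0 < m ->
  (0 < S)%N -> M * eta S <= (m / 2) `^ r^-1 ->
  (forall t, (S <= t)%N -> h t < (eta t * M / m) `^ (1 - r)^-1 \/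
    m * h t `^ (1 - r) <= g t) ->
  forall t, (S <= t)%N ->
    h t <= Num.max (h S * (eta t.-1 / eta S.-1) ^+ l)
      (eta t.-1 `^ Num.min l%:R (Num.min (1 - r)^-1 2) *
        ((M / m) `^ (1 - r)^-1 + M / 2)).
Proof.
(* Writing [S = s0 + 1] makes [S.-1] a genuine predecessor instead of the truncated [0.-1 = 0]. *)
case: S => // s0; rewrite succnK.
set p := Num.min _ _; set q := (1 - r)^-1; set B := _ + M / 2.
move=> r01 m0 _ MS dich t /subnKC <-.
have eta0 s : 0 < eta s := open_loop_step_gt0 _ _ l0 s.
have q0 : 0 < q by rewrite invr_gt0 subr_gt0; case/andP: r01.
have B0 : 0 <= B by rewrite addr_ge0 ?powR_ge0// divr_ge0// ltW.
have pq : p <= q by rewrite /p !ge_min lexx orbT.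
have p2 : p <= 2 by rewrite /p !ge_min lexx !orbT.
have pl : p <= l%:R by rewrite /p ge_min lexx.
elim: (t - s0.+1)%N => [|k IHk].
  by rewrite addn0 divff ?gt_eqF// expr1n mulr1 le_max lexx.
move: IHk; rewrite addnS addSn !succnK; set s := (s0 + k)%N => IHs.
have s0s : (s0 < s.+1)%N by rewrite ltnS leq_addr.
have [hs|hs] := ltP (h s.+1) ((eta s.+1 * M / m) `^ q).
  (* The bound at [s.+2] involves [eta s.+1], exactly the step just taken, so the second term of the
     maximum appears directly. *)
  by rewrite le_max (open_loop_small_step q p s.+1 q0 pq p2 m m0 hs) orbT.
have {dich}[/(le_lt_trans hs)|mg] := dich _ s0s; first by rewrite ltxx.
have hub : h s.+1 <= (m / 2) `^ r^-1.
  apply: le_trans (open_loop_step_bound s) (le_trans _ MS).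
  by rewrite ler_pM2l// open_loop_step_nonincr.
apply: le_trans (open_loop_growth_step r m s.+1 r01 m0 hs mg hub) _.
set rho := eta s.+1 / eta s.
have rho0 : 0 < rho by rewrite divr_gt0.
have rho1 : rho <= 1.
  by rewrite ler_pdivrMr// mul1r open_loop_step_nonincr.
apply: (@le_trans _ _ (rho ^+ l * h s.+1)).
  by rewrite ler_wpM2r//; exact: open_loop_step_contraction.
apply: le_trans (ler_wpM2l (exprn_ge0 _ (ltW rho0)) IHs) _.
rewrite maxr_pMr ?exprn_ge0 ?(ltW rho0)// ge_max !le_max; apply/andP; split.
  apply/orP; left; rewrite mulrCA -exprMn /rho.
  by rewrite mulrA divfK// gt_eqF.
apply/orP; right; rewrite mulrA ler_wpM2r//.
rewrite -[eta s.+1](divfK (lt0r_neq0 (eta0 s))) -/rho [leRHS]powRM ?(ltW rho0) ?(ltW (eta0 s))//.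
rewrite ler_wpM2r ?powR_ge0// -powR_mulrn ?(ltW rho0)//.
by rewrite /powR gt_eqF// ler_expR ler_wnM2r// ln_le0.
Qed.

End open_loop_recursion.

(** * Frank-Wolfe iterates as an instance of the recursion *)

Lemma frank_wolfe_in (R : realType) (n : nat) (C : set 'rV[R]_n)
    (f : 'rV[R]_n -> R) (eta : nat -> R) (x v : nat -> 'rV[R]_n) :
  convex_set C -> (forall t, 0 <= eta t <= 1) -> frank_wolfe C f eta x v ->
  forall t, C (x t).
Proof.
move=> Cconv eta01 [Cx0 fw]; elim=> [//|t Cxt].
have [[Cvt _] ->] := fw t; have /andP[e0 e1] := eta01 t.
have := Cconv (v t) (x t) (Itv01 e0 e1) (mem_set Cvt) (mem_set Cxt).
by rewrite inE /conv/= /unstable.onem scalerBl scale1r scalerBr addrCA.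
Qed.

Lemma dotpN (R : realType) (n : nat) (a u : 'rV[R]_n) :
  dotp a (- u) = - dotp a u.
Proof. by rewrite -sumrN; apply: eq_bigr => i _; rewrite mxE mulrN. Qed.

(** All minimizers of the linear problem share one value, so whichever vertex the oracle returns
    attains the gap. *)
Lemma fw_gapE (R : realType) (n : nat) (C : set 'rV[R]_n)
    (f : 'rV[R]_n -> R) (x v : 'rV[R]_n) :
  compact C -> fw_vertices C f x v ->
  fw_gap C f x = dotp (grad f x) (x - v).
Proof.
move=> Cc [Cv vmin].
have [|w [Cw wmin] ->] := fw_gap_max f x _ Cc; first by exists v.
rewrite -![x - _]opprB !dotpN; congr (- _); apply/eqP.
by rewrite eq_le wmin// vmin.
Qed.

(** For a minimizer [z] of [f], the gradient inequality bounds [f x - f z] by the linear decrease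
    towards [z], and the vertex [v] maximizes that decrease. *)
Lemma subopt_le_gap (R : realType) (n : nat) (C : set 'rV[R]_n)
    (f : 'rV[R]_n -> R) (x v : 'rV[R]_n) :
  compact C -> convex_function C f -> (forall y, C y -> differentiable f y) ->
  C x -> fw_vertices C f x v -> subopt C f x <= fw_gap C f x.
Proof.
move=> Cc cf df Cx xv.
have [|z [Cz zmin] ->] := subopt_min _ Cc df; first by exists x.
rewrite (fw_gapE _ _ _ _ _ _ Cc xv).
have := convex_gradient_le _ _ _ _ _ _ cf Cx Cz (df _ Cx).
by case: xv => _ /(_ _ Cz); rewrite -[x - v]opprB dotpN; lra.
Qed.

Lemma frank_wolfe_step (R : realType) (n : nat) (C : set 'rV[R]_n)
    (f : 'rV[R]_n -> R) (M e : R) (x v : 'rV[R]_n) :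
  compact C -> strong_growth0 C f M -> C x -> fw_vertices C f x v ->
  0 <= e <= 1 ->
  subopt C f (x + e *: (v - x)) <=
    subopt C f x - e * fw_gap C f x + M * e ^+ 2 / 2.
Proof.
move=> Cc gr Cx xv e01; rewrite (fw_gapE _ _ _ _ _ _ Cc xv) /subopt.
have := gr _ _ Cx xv _ e01; rewrite /bregman [x + _]addrC addrK.
have -> : dotp (grad f x) (e *: (v - x)) = - (e * dotp (grad f x) (x - v)).
  rewrite /dotp mulr_sumr -sumrN; apply: eq_bigr => i _.
  by rewrite !mxE; ring.
by move=> ?; lra.
Qed.

Theorem theorem5p2 (R : realType) (n : nat) (C U : set 'rV[R]_n)
  (f : 'rV[R]_n -> R) (l : nat) (x v : nat -> 'rV[R]_n)
  (M r m : R) (S : nat) :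
  let eta := open_loop_step R l in
  let subopt_ t := subopt C f (x t) in
  let gap_ t := fw_gap C f (x t) in
  compact C -> convex_set C ->
  open U -> C `<=` U ->
  convex_function C f -> (forall y, U y -> differentiable f y) ->
  (2 <= l)%N ->
  frank_wolfe C f eta x v ->
  0 < M -> strong_growth0 C f M ->
  0 < r < 1 -> 0 < m ->
  Num.max 1 (Num.ceil (2 `^ r^-1 * l%:R * M / m `^ r^-1 - l%:R)) <= S%:Z ->
  (forall t : nat, (S <= t)%N ->
    subopt_ t < (eta t * M / m) `^ (1 - r)^-1 \/
    m * subopt_ t `^ (1 - r) <= gap_ t) ->
  forall t : nat, (S <= t)%N ->
    subopt_ t <=
      Num.max (subopt_ S * (eta t.-1 / eta S.-1) ^+ l)
        (eta t.-1 `^ Num.min l%:R (Num.min (1 - r)^-1 2) *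
          ((M / m) `^ (1 - r)^-1 + M / 2)).
Proof.
move=> eta subopt_ gap_ Cc Cconv _ CU cf dfU l2 fw M0 gr r01 m0 Sge dich.
have l0 : (0 < l)%N := leq_trans (isT : (0 < 2)%N) l2.
have df y : C y -> differentiable f y by move=> /CU/dfU.
have eta01 t : 0 <= eta t <= 1.
  by rewrite (ltW (open_loop_step_gt0 _ _ l0 t)) open_loop_step_le1.
have Cx := frank_wolfe_in _ _ _ _ _ _ _ Cconv eta01 fw.
have xv t : fw_vertices C f (x t) (v t) by have [] := fw.2 t.
have subopt0 t : 0 <= subopt_ t.
  have [|z [Cz zmin] sE] := subopt_min _ Cc df; first by exists (x t).
  by rewrite /subopt_ sE subr_ge0 zmin.
have step t : subopt_ t.+1 <= subopt_ t - eta t * gap_ t + M * eta t ^+ 2 / 2.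
  by rewrite /subopt_ (fw.2 t).2; exact: frank_wolfe_step.
move: Sge; rewrite ge_max ceil_le_int => /andP[S0 Sge].
have r0 : 0 <= r^-1 by case/andP: r01 => r0 _; rewrite invr_ge0 ltW.
apply: open_loop_rate dich => //.
  by move=> t; exact: subopt_le_gap.
have mr0 : 0 < m `^ r^-1 by rewrite powR_gt0.
have r20 : 0 < 2 `^ r^-1 :> R by rewrite powR_gt0.
have -> : (m / 2) `^ r^-1 = m `^ r^-1 / 2 `^ r^-1.
  apply: (mulIf (lt0r_neq0 r20)); rewrite divfK ?gt_eqF//.
  by rewrite -powRM ?divr_ge0 ?(ltW m0)// divfK.
rewrite /open_loop_step mulrA ler_pdivrMr; last first.
  by rewrite -natrD ltr0n addn_gt0 l0 orbT.
move: Sge; rewrite lerBlDr ler_pdivrMr// => Sge.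
rewrite mulrAC ler_pdivlMr//.
by move: Sge; rewrite pmulrn; lra.
Qed.
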